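(* Let $\ell\in\mathbb{N}_{0}$. Let $\mathfrak{G}:\mathbb{R}^3\to\mathbb{R}$ be either of the following two functions: first, $$\mathfrak{G}(x,y,z)=Q_{4\ell+1}(x,y)\sin z+Q_{4\ell+1}(x,z)\sin y+Q_{4\ell+1}(z,x)\cos y-Q_{4\ell+1}(y,x)\cos z,$$ or, second, $$\begin{aligned}\mathfrak{G}(x,y,z)={}&Q_{4\ell+3}(x,y)\sin z+Q_{4\ell+3}(x,z)\sin y+(8\ell+6)Q_{4\ell+2}(y,z)\cos x\\&+Q_{4\ell+3}(z,x)\cos y-Q_{4\ell+3}(y,x)\cos z\\&-(8\ell+6)P_{4\ell+2}(y,z)\sin x\\&+(8\ell+6)(4\ell+2)P_{4\ell+1}(x,y)\cos z-(8\ell+6)(4\ell+2)P_{4\ell+1}(x,z)\cos y.\end{aligned}$$ Then, in each of the two cases, the vector field on $\mathbb{R}^3$ defined by $$\mathfrak{V}(x,y,z)=\big(\mathfrak{G}(x,y,z),\,\mathfrak{G}(y,z,x),\,\mathfrak{G}(z,x,y)\big)$$ has the tetrahedral symmetry $\mathbb{T}$ and satisfies $\nabla\times\mathfrak{V}=\mathfrak{V}$.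
   Context: For an integer $n\ge 0$, $P_n(x,y)=\Re\big((x+iy)^n\big)$ and $Q_n(x,y)=\Im\big((x+iy)^n\big)$ for real $x,y$. $\mathbb{N}_0=\{0,1,2,\dots\}$, and $\nabla\times$ is the usual curl on $\mathbb{R}^3$ with coordinates $(x,y,z)$. The tetrahedral group $\mathbb{T}$ (of order $12$) is the subgroup of $\mathrm{GL}(3,\mathbb{R})$ generated by $$\alpha=\begin{pmatrix}1&0&0\\0&-1&0\\0&0&-1\end{pmatrix},\qquad \gamma=\begin{pmatrix}0&1&0\\0&0&1\\1&0&0\end{pmatrix},$$ acting on column vectors $(x,y,z)^T$. A vector field $F$, regarded as a map $\mathbb{R}^3\to\mathbb{R}^3$, has symmetry $\Gamma$ (for a group $\Gamma\subset\mathrm{GL}(3,\mathbb{R})$) if $\epsilon^{-1}\circ F\circ\epsilon=F$ for every $\epsilon\in\Gamma$. *)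

(* Defs.v *)
(* The real numbers are an arbitrary R : realType, and R^3 is the type
   'cV[R]_3 of column vectors. *)
From HB Require Import structures.
From mathcomp Require Import all_boot all_order all_algebra.
From mathcomp Require Import all_classical all_reals all_analysis.
From mathcomp.real_closed Require Import complex.

Set Implicit Arguments.
Unset Strict Implicit.
Unset Printing Implicit Defensive.

Import Order.TTheory GRing.Theory Num.Theory.
Import numFieldNormedType.Exports.

Local Open Scope classical_set_scope.
Local Open Scope ring_scope.

Definition P (R : realType) (n : nat) (x y : R) : R :=
  complex.Re ((x +i* y)%C ^+ n).

Definition Q (R : realType) (n : nat) (x y : R) : R :=
  complex.Im ((x +i* y)%C ^+ n).

Definition vec3 (R : realType) (x y z : R) : 'cV[R]_3 :=
  \col_(i < 3) nth 0 [:: x; y; z] i.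

(* The numerals 0, 1, 2 used as indices live in 'I_3. *)
Definition partial (R : realType) (j i : 'I_3) (F : 'cV[R]_3 -> 'cV[R]_3)
    (p : 'cV[R]_3) : R :=
  'D_(delta_mx j 0) (fun q => F q i 0) p.

(* The derivative operator 'D is total, with an unspecified value where the
   limit does not exist; [curl] is to be read together with differentiability
   of F. *)
Definition curl (R : realType) (F : 'cV[R]_3 -> 'cV[R]_3) (p : 'cV[R]_3) :
    'cV[R]_3 :=
  vec3 (partial 1 2 F p - partial 2 1 F p)
       (partial 2 0 F p - partial 0 2 F p)
       (partial 0 1 F p - partial 1 0 F p).

Definition mx3 (R : realType) (rows : seq (seq R)) : 'M[R]_3 :=
  \matrix_(i < 3, j < 3) nth 0 (nth [::] rows i) j.

Definition alpha (R : realType) : 'M[R]_3 :=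
  mx3 [:: [:: 1;  0;  0];
          [:: 0; -1;  0];
          [:: 0;  0; -1]].

Definition gamma (R : realType) : 'M[R]_3 :=
  mx3 [:: [:: 0; 1; 0];
          [:: 0; 0; 1];
          [:: 1; 0; 0]].

Definition GL3_subgroup (R : realType) (H : set 'M[R]_3) : Prop :=
  [/\ H `<=` [set A | A \in unitmx],
      H 1%:M,
      forall A B, H A -> H B -> H (A *m B)
    & forall A, H A -> H (invmx A)].

Definition tetrahedral (R : realType) : set 'M[R]_3 :=
  smallest (@GL3_subgroup R) [set alpha R; gamma R].
Arguments tetrahedral : clear implicits.

(* [mulmx e] is the linear map p |-> e *m p of R^3. *)
Definition has_symmetry (R : realType) (Gamma : set 'M[R]_3)
    (F : 'cV[R]_3 -> 'cV[R]_3) : Prop :=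
  forall e, Gamma e -> mulmx (invmx e) \o F \o mulmx e = F.

Definition G_first (R : realType) (l : nat) (x y z : R) : R :=
  Q (4 * l + 1) x y * sin z + Q (4 * l + 1) x z * sin y
  + Q (4 * l + 1) z x * cos y - Q (4 * l + 1) y x * cos z.

Definition G_second (R : realType) (l : nat) (x y z : R) : R :=
  Q (4 * l + 3) x y * sin z + Q (4 * l + 3) x z * sin y
  + (8 * l + 6)%:R * Q (4 * l + 2) y z * cos x
  + Q (4 * l + 3) z x * cos y - Q (4 * l + 3) y x * cos z
  - (8 * l + 6)%:R * P (4 * l + 2) y z * sin x
  + (8 * l + 6)%:R * (4 * l + 2)%:R * P (4 * l + 1) x y * cos z
  - (8 * l + 6)%:R * (4 * l + 2)%:R * P (4 * l + 1) x z * cos y.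

Definition cyclic_field (R : realType) (G : R -> R -> R -> R)
    (p : 'cV[R]_3) : 'cV[R]_3 :=
  let x := p 0 0 in let y := p 1 0 in let z := p 2 0 in
  vec3 (G x y z) (G y z x) (G z x y).

(* Main.v *)
(* The matrices e in GL(3) with F (e p) = e F(p) form a group, so the symmetry
   need only be tested on alpha and gamma; gamma permutes the components of a
   cyclic field, and alpha is a matter of parity of P_n and Q_n. By cyclicity
   the curl equation reduces to d_y G(z,x,y) - d_z G(y,z,x) = G(x,y,z). Since
   y + ix = i conj(x + iy), exchanging x and y fixes P_{4l} and negates Q_{4l};
   expressing everything through these two polynomials by the recurrences for
   P_{n+1} and Q_{n+1} turns the equation into a polynomial identity. *)
Require Import Defs.
From HB Require Import structures.
From mathcomp Require Import all_boot all_order all_algebra.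
From mathcomp Require Import all_classical all_reals all_analysis.
From mathcomp.real_closed Require Import complex.
From mathcomp Require Import ring.
Import Order.TTheory GRing.Theory Num.Theory.
Import numFieldNormedType.Exports.
Local Open Scope classical_set_scope.
Local Open Scope ring_scope.

Set Implicit Arguments.
Unset Strict Implicit.

Section TetrahedralBeltrami.
Variable R : realType.
Implicit Types (n l : nat) (x y : R).

(** * Recurrences, parity and exchange of variables for [P] and [Q] *)

Lemma PS n x y : P n.+1 x y = x * P n x y - y * Q n x y.
Proof. by rewrite /P /Q exprS; case: (_ ^+ n). Qed.

Lemma QS n x y : Q n.+1 x y = x * Q n x y + y * P n x y.
Proof. by rewrite /P /Q exprS; case: (_ ^+ n). Qed.

Lemma P0 x y : P 0 x y = 1. Proof. by rewrite /P expr0. Qed.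
Lemma Q0 x y : Q 0 x y = 0. Proof. by rewrite /Q expr0. Qed.

(** Conjugation commutes with powers. The two statements are joined because each recurrence involves
    both [P] and [Q]. *)
Lemma PQNr n x y : P n x (- y) = P n x y /\ Q n x (- y) = - Q n x y.
Proof.
elim: n => [|n [IHP IHQ]]; first by rewrite !P0 !Q0 oppr0.
by rewrite !PS !QS IHP IHQ; split; ring.
Qed.

Lemma PNr n x y : P n x (- y) = P n x y.
Proof. by have [] := PQNr n x y. Qed.

Lemma QNr n x y : Q n x (- y) = - Q n x y.
Proof. by have [] := PQNr n x y. Qed.

(** Here -x + iy is minus the conjugate of x + iy, whence the sign (-1)^n. *)
Lemma PQNl n x y :
  P n (- x) y = (-1) ^+ n * P n x y /\ Q n (- x) y = - (-1) ^+ n * Q n x y.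
Proof.
elim: n => [|n [IHP IHQ]]; first by rewrite !P0 !Q0 !mulr0 expr0 mulr1.
by rewrite !PS !QS IHP IHQ exprS; split; ring.
Qed.

Lemma PNl n x y : P n (- x) y = (-1) ^+ n * P n x y.
Proof. by have [] := PQNl n x y. Qed.

Lemma QNl n x y : Q n (- x) y = - (-1) ^+ n * Q n x y.
Proof. by have [] := PQNl n x y. Qed.

(* y + ix = i * conj (x + iy), and i ^ (4 l) = 1. *)
Lemma PQ4C l x y :
  P (4 * l) y x = P (4 * l) x y /\ Q (4 * l) y x = - Q (4 * l) x y.
Proof.
elim: l => [|l [IHP IHQ]]; first by rewrite !P0 !Q0 oppr0.
by rewrite mulnS !addSn add0n !(PS, QS) IHP IHQ; split; ring.
Qed.

Lemma P4C l x y : P (4 * l) y x = P (4 * l) x y.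
Proof. by have [] := PQ4C l x y. Qed.

Lemma Q4C l x y : Q (4 * l) y x = - Q (4 * l) x y.
Proof. by have [] := PQ4C l x y. Qed.

(** * Partial derivatives of [P] and [Q] *)

(* At n = 0 the truncated predecessor is harmless: its coefficient vanishes. *)
Lemma is_derive_PQ1 n x y :
  is_derive x 1 (fun t => P n t y) (n%:R * P n.-1 x y) /\
  is_derive x 1 (fun t => Q n t y) (n%:R * Q n.-1 x y).
Proof.
elim: n => [|n [IHP IHQ]].
  rewrite !mul0r; split.
    rewrite (_ : (fun t => _) = cst 1); first exact: is_derive_cst.
    by apply/funext => t; rewrite P0.
  rewrite (_ : (fun t => _) = cst 0); first exact: is_derive_cst.
  by apply/funext => t; rewrite Q0.
split.
  rewrite (_ : (fun t => _) = id * P n ^~ y - cst y * Q n ^~ y); last first.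
    by apply/funext => t; rewrite PS.
  apply: is_derive_eq.
  rewrite /cst /GRing.scale /=.
  case: n {IHP IHQ} => [|n]; first by rewrite P0; ring.
  by rewrite /= PS; ring.
rewrite (_ : (fun t => _) = id * Q n ^~ y + cst y * P n ^~ y); last first.
  by apply/funext => t; rewrite QS.
apply: is_derive_eq.
rewrite /cst /GRing.scale /=.
case: n {IHP IHQ} => [|n]; first by rewrite Q0; ring.
by rewrite /= QS; ring.
Qed.

(** The y-derivative of (x + iy)^n is i n (x + iy)^(n-1); the factor i exchanges real and imaginary
    parts and brings in the sign. *)
Lemma is_derive_PQ2 n x y :
  is_derive y 1 (fun t => P n x t) (- n%:R * Q n.-1 x y) /\
  is_derive y 1 (fun t => Q n x t) (n%:R * P n.-1 x y).
Proof.
elim: n => [|n [IHP IHQ]].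
  rewrite oppr0 !mul0r; split.
    rewrite (_ : (fun t => _) = cst 1); first exact: is_derive_cst.
    by apply/funext => t; rewrite P0.
  rewrite (_ : (fun t => _) = cst 0); first exact: is_derive_cst.
  by apply/funext => t; rewrite Q0.
split.
  rewrite (_ : (fun t => _) = cst x * P n x - id * Q n x); last first.
    by apply/funext => t; rewrite PS.
  apply: is_derive_eq.
  rewrite /cst /GRing.scale /=.
  case: n {IHP IHQ} => [|n]; first by rewrite Q0; ring.
  by rewrite /= QS; ring.
rewrite (_ : (fun t => _) = cst x * Q n x + id * P n x); last first.
  by apply/funext => t; rewrite QS.
apply: is_derive_eq.
rewrite /cst /GRing.scale /=.
case: n {IHP IHQ} => [|n]; first by rewrite P0; ring.
by rewrite /= PS; ring.
Qed.

Lemma is_derive_P1 n x y :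
  is_derive x 1 (P n ^~ y) (n%:R * P n.-1 x y).
Proof. by have [] := is_derive_PQ1 n x y. Qed.

Lemma is_derive_Q1 n x y :
  is_derive x 1 (Q n ^~ y) (n%:R * Q n.-1 x y).
Proof. by have [] := is_derive_PQ1 n x y. Qed.

Lemma is_derive_P2 n x y :
  is_derive y 1 (P n x) (- n%:R * Q n.-1 x y).
Proof. by have [] := is_derive_PQ2 n x y. Qed.

Lemma is_derive_Q2 n x y :
  is_derive y 1 (Q n x) (n%:R * P n.-1 x y).
Proof. by have [] := is_derive_PQ2 n x y. Qed.

(** * Differentiability on a normed space *)

Lemma differentiable_PQ (V : normedModType R) (u v : V -> R) (p : V) n :
  differentiable u p -> differentiable v p ->
  differentiable (fun q => P n (u q) (v q)) p /\
  differentiable (fun q => Q n (u q) (v q)) p.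
Proof.
move=> du dv; elim: n => [|n [dP dQ]].
  split.
    rewrite (_ : (fun q => _) = cst 1); first exact: differentiable_cst.
    by apply/funext => q; rewrite P0.
  rewrite (_ : (fun q => _) = cst 0); first exact: differentiable_cst.
  by apply/funext => q; rewrite Q0.
split; [under eq_fun do rewrite PS | under eq_fun do rewrite QS].
  by apply: differentiableB; apply: differentiableM.
by apply: differentiableD; apply: differentiableM.
Qed.

Lemma differentiable_P (V : normedModType R) (u v : V -> R) (p : V) n :
  differentiable u p -> differentiable v p ->
  differentiable (fun q => P n (u q) (v q)) p.
Proof. by move=> du dv; have [] := differentiable_PQ n du dv. Qed.

Lemma differentiable_Q (V : normedModType R) (u v : V -> R) (p : V) n :
  differentiable u p -> differentiable v p ->
  differentiable (fun q => Q n (u q) (v q)) p.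
Proof. by move=> du dv; have [] := differentiable_PQ n du dv. Qed.

Lemma differentiable_sin_comp (V : normedModType R) (u : V -> R) (p : V) :
  differentiable u p -> differentiable (fun q => sin (u q)) p.
Proof.
move=> du; apply: (differentiable_comp du).
exact/derivable1_diffP/ex_derive.
Qed.

Lemma differentiable_cos_comp (V : normedModType R) (u : V -> R) (p : V) :
  differentiable u p -> differentiable (fun q => cos (u q)) p.
Proof.
move=> du; apply: (differentiable_comp du).
exact/derivable1_diffP/ex_derive.
Qed.

Ltac differentiate :=
  repeat match goal with
  | |- differentiable (fun q => @?f q - @?g q) _ =>
      apply: (@differentiableB _ _ _ f g)
  | |- differentiable (fun q => @?f q + @?g q) _ =>
      apply: (@differentiableD _ _ _ f g)
  | |- differentiable (fun q => @?f q * @?g q) _ =>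
      apply: (@differentiableM _ _ f g)
  | |- differentiable (fun q => sin (@?f q)) _ =>
      apply: (@differentiable_sin_comp _ f)
  | |- differentiable (fun q => cos (@?f q)) _ =>
      apply: (@differentiable_cos_comp _ f)
  | |- differentiable (fun q => P _ (@?f q) (@?g q)) _ =>
      apply: (@differentiable_P _ f g)
  | |- differentiable (fun q => Q _ (@?f q) (@?g q)) _ =>
      apply: (@differentiable_Q _ f g)
  end; try by []; try exact: differentiable_cst.

Lemma differentiable_G_first (V : normedModType R) (u v w : V -> R) (p : V) l :
  differentiable u p -> differentiable v p -> differentiable w p ->
  differentiable (fun q => G_first l (u q) (v q) (w q)) p.
Proof.
move=> du dv dw; rewrite /G_first.
differentiate.
Qed.

Lemma differentiable_G_second (V : normedModType R) (u v w : V -> R) (p : V) l :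
  differentiable u p -> differentiable v p -> differentiable w p ->
  differentiable (fun q => G_second l (u q) (v q) (w q)) p.
Proof.
move=> du dv dw; rewrite /G_second.
differentiate.
Qed.

(** * The curl equation for the scalar functions *)

(* The premises are kept away from typeclass resolution, which is slow here
   because it tries to match P and Q against every operation on functions. *)
Ltac derive_rules :=
  repeat match goal with
  | |- is_derive _ _ (fun t => ?c) _ => exact: (is_derive_cst c)
  | |- is_derive _ _ (fun t => @?f t - @?g t) _ =>
      simple notypeclasses refine (@is_deriveB _ _ _ f g _ _ _ _ _ _)
  | |- is_derive _ _ (fun t => @?f t + @?g t) _ =>
      simple notypeclasses refine (@is_deriveD _ _ _ f g _ _ _ _ _ _)
  | |- is_derive _ _ (fun t => @?f t * @?g t) _ =>
      simple notypeclasses refine (@is_deriveM _ _ f g _ _ _ _ _ _)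
  | |- is_derive _ _ (fun t => sin t) _ => exact: is_derive_sin
  | |- is_derive _ _ (fun t => cos t) _ => exact: is_derive_cos
  | |- is_derive _ _ (fun t => P _ t _) _ => exact: is_derive_P1
  | |- is_derive _ _ (fun t => P _ _ t) _ => exact: is_derive_P2
  | |- is_derive _ _ (fun t => Q _ t _) _ => exact: is_derive_Q1
  | |- is_derive _ _ (fun t => Q _ _ t) _ => exact: is_derive_Q2
  end.

(** The final identities hold with the values of [P], [Q], [sin] and [cos] as independent
    indeterminates. *)
Ltac generalize_atoms :=
  repeat match goal with
  | |- context [P ?n ?a ?b] => move: (P n a b) => ?
  | |- context [Q ?n ?a ?b] => move: (Q n a b) => ?
  | |- context [sin ?a] => move: (sin a) => ?
  | |- context [cos ?a] => move: (cos a) => ?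
  end.

Lemma derive_val_sub (f g : R -> R) x y df dg d :
  is_derive x 1 f df -> is_derive y 1 g dg -> df - dg = d ->
  'D_1 f x - 'D_1 g y = d.
Proof. by move=> ? ? <-; rewrite !derive_val. Qed.

(** Differentiating [sin] and [cos] reproduces all terms of [G_first]. The derivatives of the [Q]
    factors are multiples of P_{4l} and Q_{4l} and cancel by the exchange symmetry. *)
Lemma G_first_curl l x y z :
  'D_1 (G_first l z x) y - 'D_1 (fun t => G_first l y t x) z = G_first l x y z.
Proof.
rewrite /G_first.
(* The derivatives [df] and [dg] stay existential variables, which [derive_rules] fills in. *)
simple notypeclasses refine (derive_val_sub _ _ _);
  [| | derive_rules | derive_rules | ].
rewrite /GRing.scale /= !addn1 /= !(PS, QS).
(* Ordering the arguments leaves only P_{4l} and Q_{4l} at (x,y), (x,z) and (y,z). *)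
rewrite !(P4C l y x) !(P4C l z x) !(P4C l z y).
rewrite !(Q4C l y x) !(Q4C l z x) !(Q4C l z y).
by generalize_atoms; ring.
Qed.

(** Put n = 4l + 3. Exchange negates P_{n-1} and fixes Q_{n-1}, so their two contributions add up,
    which accounts for the coefficient 2n = 8l + 6. Differentiating these terms yields the factor
    2n(n-1), and what is left over in degrees n-2 and n-3 cancels. *)
Lemma G_second_curl l x y z :
  'D_1 (G_second l z x) y - 'D_1 (fun t => G_second l y t x) z
  = G_second l x y z.
Proof.
rewrite /G_second.
simple notypeclasses refine (derive_val_sub _ _ _);
  [| | derive_rules | derive_rules | ].
rewrite /GRing.scale /= !(addn1, addn2, addn3) /= !(PS, QS).
rewrite !(P4C l y x) !(P4C l z x) !(P4C l z y).
rewrite !(Q4C l y x) !(Q4C l z x) !(Q4C l z y).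
by generalize_atoms; ring.
Qed.

(** * Parity of the scalar functions *)

Lemma sign4Dn l k : (-1) ^+ (4 * l + k) = (-1) ^+ k :> R.
Proof. by rewrite exprD exprM -signr_odd /= expr1n mul1r. Qed.

(** The three equations are, in this order, what [alpha] demands of the first, second and third
    component of a cyclic field. *)
Lemma G_first_flip l x y z :
  [/\ G_first l x (- y) (- z) = G_first l x y z,
      G_first l (- x) (- y) z = - G_first l x y z
    & G_first l (- x) y (- z) = - G_first l x y z].
Proof.
rewrite /G_first !(PNl, PNr, QNl, QNr, sinN, cosN) !sign4Dn.
by split; generalize_atoms; ring.
Qed.

Lemma G_second_flip l x y z :
  [/\ G_second l x (- y) (- z) = G_second l x y z,
      G_second l (- x) (- y) z = - G_second l x y z
    & G_second l (- x) y (- z) = - G_second l x y z].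
Proof.
rewrite /G_second !(PNl, PNr, QNl, QNr, sinN, cosN) !sign4Dn.
by split; generalize_atoms; ring.
Qed.

(** * Coordinates and the curl of a cyclic field *)

(** The vectors on the right are constant, so differentiability of a field reduces to that of its
    components. *)
Lemma vec3_delta (a b c : R) : vec3 a b c =
  a *: delta_mx 0 0 + b *: delta_mx 1 0 + c *: delta_mx (2 : 'I_3) 0.
Proof.
apply/colP => i; rewrite !mxE.
by case: i => [[|[|[|//]]] ?] /=; rewrite ?(mulr1, mulr0, addr0, add0r).
Qed.

Lemma vec3E (a b c : R) :
  (vec3 a b c 0 0 = a) * (vec3 a b c 1 0 = b) * (vec3 a b c 2 0 = c).
Proof. by rewrite !mxE. Qed.

Lemma eq_col3 (u v : 'cV[R]_3) :
  u 0 0 = v 0 0 -> u 1 0 = v 1 0 -> u 2 0 = v 2 0 -> u = v.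
Proof.
move=> e0 e1 e2; apply/colP => -[[|[|[|//]]] i3] /=.
- by rewrite (_ : Ordinal i3 = 0) //; apply/val_inj.
- by rewrite (_ : Ordinal i3 = 1) //; apply/val_inj.
- by rewrite (_ : Ordinal i3 = 2) //; apply/val_inj.
Qed.

(* Both sides are limits of the same difference quotient, so that no
   derivability is needed. *)
Lemma partial_coord (j i : 'I_3) (F : 'cV[R]_3 -> 'cV[R]_3) (p : 'cV[R]_3)
    (f : R -> R) :
  (forall t, F (t *: delta_mx j 0 + p) i 0 = f (t + p j 0)) ->
  partial j i F p = 'D_1 f (p j 0).
Proof.
move=> Ff; rewrite /partial /derive; congr (lim (_ @ 0^')).
apply/funext => h /=; rewrite Ff [h%:A]mulr1; congr (_ *: (_ - _)).
(* The value at the base point is the hypothesis at [t = 0]. *)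
by rewrite -[p in LHS]add0r -(scale0r (delta_mx j 0)) Ff add0r.
Qed.

Lemma curl_cyclic_field (G : R -> R -> R -> R) :
  (forall x y z, 'D_1 (G z x) y - 'D_1 (fun t => G y t x) z = G x y z) ->
  curl (cyclic_field G) = cyclic_field G.
Proof.
move=> GE; apply/funext => p; rewrite /curl.
have coordE j k t : (t *: delta_mx j 0 + p) k 0 = t *+ (k == j) + p k 0.
  by rewrite !mxE andbT mulr_natr.
rewrite (@partial_coord 1 2 _ _ (G (p 2 0) (p 0 0))); last first.
  by move=> t; rewrite vec3E !coordE /= !add0r.
rewrite (@partial_coord 2 1 _ _ (fun t => G (p 1 0) t (p 0 0))); last first.
  by move=> t; rewrite vec3E !coordE /= !add0r.
rewrite (@partial_coord 2 0 _ _ (G (p 0 0) (p 1 0))); last first.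
  by move=> t; rewrite vec3E !coordE /= !add0r.
rewrite (@partial_coord 0 2 _ _ (fun t => G (p 2 0) t (p 1 0))); last first.
  by move=> t; rewrite vec3E !coordE /= !add0r.
rewrite (@partial_coord 0 1 _ _ (G (p 1 0) (p 2 0))); last first.
  by move=> t; rewrite vec3E !coordE /= !add0r.
rewrite (@partial_coord 1 0 _ _ (fun t => G (p 0 0) t (p 2 0))); last first.
  by move=> t; rewrite vec3E !coordE /= !add0r.
(* The three components are the hypothesis at the cyclic shifts of the coordinates. *)
by rewrite !GE.
Qed.

Lemma differentiable_cyclic_field (G : R -> R -> R -> R) (p : 'cV[R]_3) :
  (forall u v w : 'cV[R]_3 -> R, differentiable u p -> differentiable v p ->
    differentiable w p -> differentiable (fun q => G (u q) (v q) (w q)) p) ->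
  differentiable (cyclic_field G) p.
Proof.
move=> dG; rewrite /cyclic_field.
under eq_fun do rewrite vec3_delta.
have dc i : differentiable (fun q : 'cV[R]_3 => q i 0) p.
  exact: differentiable_coord.
by do 2?apply: differentiableD; apply: differentiableZl; exact: dG.
Qed.

(** * Tetrahedral symmetry *)

Lemma has_symmetry_tetrahedral (F : 'cV[R]_3 -> 'cV[R]_3) :
  (forall p, F (alpha R *m p) = alpha R *m F p) ->
  (forall p, F (gamma R *m p) = gamma R *m F p) ->
  has_symmetry (tetrahedral R) F.
Proof.
move=> Fa Fg e.
pose H : set 'M[R]_3 :=
  [set A | A \in unitmx /\ forall p, F (A *m p) = A *m F p].
have HG : GL3_subgroup H.
  split=> [A []//||A B [uA FA] [uB FB]|A [uA FA]].
  - by split=> [|p]; rewrite ?unitmx1 ?mul1mx.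
  - by split=> [|p]; rewrite ?unitmx_mul ?uA // -!mulmxA FA FB.
  - split=> [|p]; first by rewrite unitmx_inv.
    (* Since p = A (A^{-1} p), equivariance under A gives F(p) = A F(A^{-1} p). *)
    by rewrite -[RHS](congr1 _ (congr1 F (mulKVmx uA p))) FA mulKmx.
have Hgen : [set alpha R; gamma R] `<=` H.
  (* For invertibility: [alpha] is its own inverse, and [gamma], a permutation matrix, has its
     transpose as inverse. *)
  move=> A [->|->]; split=> //.
  - have /mulmx1_unit[] // : alpha R *m alpha R = 1%:M.
    apply/matrixP => i j; rewrite !mxE !big_ord_recr big_ord0 /= !mxE.
    by case: i => [[|[|[|//]]] ?]; case: j => [[|[|[|//]]] ?] /=; ring.
  - have /mulmx1_unit[] // : gamma R *m (gamma R)^T = 1%:M.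
    apply/matrixP => i j; rewrite !mxE !big_ord_recr big_ord0 /= !mxE.
    by case: i => [[|[|[|//]]] ?]; case: j => [[|[|[|//]]] ?] /=; ring.
move=> /(smallest_sub HG Hgen) [ue Fe].
by apply/funext => p /=; rewrite Fe mulKmx.
Qed.

Lemma mulmx3E (A : 'M[R]_3) (p : 'cV[R]_3) i :
  (A *m p) i 0 = A i 0 * p 0 0 + A i 1 * p 1 0 + A i 2 * p 2 0.
Proof.
rewrite mxE !big_ord_recr big_ord0 /= add0r.
by congr (A i _ * p _ _ + A i _ * p _ _ + A i _ * p _ _); apply/val_inj.
Qed.

Lemma cyclic_field_symmetry (G : R -> R -> R -> R) :
  (forall x y z, G x (- y) (- z) = G x y z) ->
  (forall x y z, G (- x) (- y) z = - G x y z) ->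
  (forall x y z, G (- x) y (- z) = - G x y z) ->
  has_symmetry (tetrahedral R) (cyclic_field G).
Proof.
move=> Gx Gz Gy; apply: has_symmetry_tetrahedral => p.
  apply: eq_col3; rewrite mulmx3E /cyclic_field !vec3E !mulmx3E !mxE /=.
  - by rewrite !(mul0r, mul1r, mulN1r, addr0, add0r) Gx.
  - by rewrite !(mul0r, mul1r, mulN1r, addr0, add0r) Gz.
  - by rewrite !(mul0r, mul1r, mulN1r, addr0, add0r) Gy.
by apply: eq_col3; rewrite mulmx3E /cyclic_field !vec3E !mulmx3E !mxE /=;
  rewrite !(mul0r, mul1r, addr0, add0r).
Qed.

End TetrahedralBeltrami.

Theorem theorem1 (R : realType) (l : nat) (G : R -> R -> R -> R)
    (hG : G = @G_first R l \/ G = @G_second R l) :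
  [/\ has_symmetry (tetrahedral R) (cyclic_field G),
      forall p : 'cV[R]_3, differentiable (cyclic_field G) p
    & curl (cyclic_field G) = cyclic_field G].
Proof.
case: hG => ->; split.
- by apply: cyclic_field_symmetry => x y z; have [] := G_first_flip l x y z.
- move=> p; apply: differentiable_cyclic_field => u v w.
  exact: differentiable_G_first.
- by apply: curl_cyclic_field => x y z; exact: G_first_curl.
- by apply: cyclic_field_symmetry => x y z; have [] := G_second_flip l x y z.
- move=> p; apply: differentiable_cyclic_field => u v w.
  exact: differentiable_G_second.
- by apply: curl_cyclic_field => x y z; exact: G_second_curl.
Qed.
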